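(* Let $L>0$, $\Omega=(-L,L)$, and $f(x)=\lambda x$ with $\lambda>0$. Moreover let $w\in L^\infty(\Omega)$ with $w\ge0$. Then a solution to the problem $$\min_{u\in BV(\Omega)}\ \frac12\int_\Omega w(f-u)^2\,dx+|Du|(\Omega)$$ will be of the following form: $$u(x)=\begin{cases}\lambda x_1,& \text{if } x\in(-L,x_1),\\ \lambda x,& \text{if } x\in[x_1,x_2],\\ \lambda x_2,& \text{if } x\in(x_2,L),\end{cases}\qquad\text{where } -L<x_1\le x_2<L.$$
   Context: $BV(\Omega)$ is the space of functions of bounded variation on $\Omega$, i.e. functions $u\in L^1(\Omega)$ whose distributional derivative $Du$ is a finite Radon measure; $|Du|(\Omega)$ denotes the total variation of $u$. *)

(* Defs.v *)
From HB Require Import structures.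
From mathcomp Require Import all_boot all_order all_algebra.
From mathcomp Require Import all_classical all_reals all_analysis.

Set Implicit Arguments.
Unset Strict Implicit.
Unset Printing Implicit Defensive.

Import Order.TTheory GRing.Theory Num.Theory.
Import numFieldNormedType.Exports.

Local Open Scope classical_set_scope.
Local Open Scope ring_scope.

(* Charges are finite and every finite Borel measure on the line is Radon, so
   charges on the Borel sets play the role of finite (signed) Radon measures;
   a measure on an open set D is given by a charge on the whole line of which
   only the values on subsets of D are used. *)
Section charge_integral.
Context d (T : measurableType d) (R : realType).
Variable nu : {charge set T -> \bar R}.

Definition hahn_P : set T := sval (cid (Hahn_decomposition nu)).

Definition hahn_N : set T := sval (cid (svalP (cid (Hahn_decomposition nu)))).

Lemma hahn_PN : hahn_decomposition nu hahn_P hahn_N.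
Proof. exact: (svalP (cid (svalP (cid (Hahn_decomposition nu))))). Qed.

Definition cvariation (D : set T) : \bar R := charge_variation hahn_PN D.

Definition cintegral (D : set T) (phi : T -> R) : R :=
  \int[jordan_pos hahn_PN]_(x in D) phi x -
  \int[jordan_neg hahn_PN]_(x in D) phi x.

End charge_integral.

Section bounded_variation.
Variable R : realType.
Implicit Types (D : set R) (u v w f phi : R -> R).
Local Notation mu := (@lebesgue_measure R).
Local Notation charges := ({charge set (measurableTypeR R) -> \bar R}%type).

Definition smooth phi : Prop := forall n x, derivable (derive1n n phi) x 1.

Definition support_of phi : set R := closure [set x | phi x != 0].

Definition test_function D phi : Prop :=
  [/\ smooth phi, compact (support_of phi) & support_of phi `<=` D].

Definition distributional_derivative D u (nu : charges) : Prop :=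
  forall phi, test_function D phi ->
    \int[mu]_(x in D) (u x * derive1 phi x) = - cintegral nu D phi.

Definition BV D : set (R -> R) :=
  [set u | mu.-integrable D (EFin \o u) /\
           exists nu : charges, distributional_derivative D u nu].

(* |Du|(D). For D open and u in BV D, the charges representing Du all agree
   on the measurable subsets of D, so that the infimum runs over a single
   value. *)
Definition variation_of_derivative D u : \bar R :=
  ereal_inf [set cvariation nu D |
             nu in [set nu : charges | distributional_derivative D u nu]].

Definition energy D w f u : \bar R :=
  ((2^-1)%:E * \int[mu]_(x in D) (w x * (f x - u x) ^+ 2)%:E
   + variation_of_derivative D u)%E.

Definition is_solution D w f u : Prop :=
  BV D u /\ forall v, BV D v -> (energy D w f u <= energy D w f v)%E.

End bounded_variation.

(* Main.v *)
(* The dual certificate is the derivative g = w (u - f) of the fidelity term at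
   the candidate u.  With f(x) = lambda x it is nonnegative on (-L, x1), zero on
   [x1, x2] and nonpositive on (x2, L), so its primitive vanishing at -L rises
   from 0 to lambda int w (x1 - x)^+ and then decreases by
   lambda int w (x - x2)^+.  If both amounts are equal to some s <= 1, then
   |int g v| <= |Dv| for every v in BV; if moreover s = 1 or x1 = x2, then
   - int g u = lambda (x2 - x1) = |Du|, and convexity of the fidelity term makes
   u a minimizer.  Such x1 <= x2 exist: the two moments are continuous and
   monotone in the threshold, so they agree at some common threshold c; take
   x1 = x2 = c if their value is at most 1, and otherwise move x1 to the left
   and x2 to the right of c until both are 1.

   The bound |int g v| <= |Dv| follows from the representation
   v(x) = Dv((-L, x]) + const almost everywhere and Fubini. *)
Require Import Defs.
From mathcomp Require Import lra.
From HB Require Import structures.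
From mathcomp Require Import all_boot all_order all_algebra.
From mathcomp Require Import all_classical all_reals all_analysis.
From mathcomp Require Import measurable_realfun ess_sup_inf.

Set Implicit Arguments.
Unset Strict Implicit.
Unset Printing Implicit Defensive.

Import Order.TTheory GRing.Theory Num.Theory.
Import numFieldNormedType.Exports.

Local Open Scope classical_set_scope.
Local Open Scope ring_scope.

(** * Smooth cutoff functions built from [exp (-1/x)] *)

Section smooth_cutoff.
Variable R : realType.
Implicit Types (p : {poly R}) (f g : R -> R) (a b x : R).

(** Each monomial [y ^+ n] is at most [n!] times the exponential, by comparison with a single term
    of its series. *)
Lemma horner_le_expR p : exists2 C, 0 <= C &
  forall y, 0 <= y -> `|p.[y]| <= C * expR y.
Proof.
exists (\sum_(i < size p) `|p`_i| * i`!%:R).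
  by apply: sumr_ge0 => i _; rewrite mulr_ge0.
move=> y y0; rewrite horner_coef mulr_suml (le_trans (ler_norm_sum _ _ _))//.
apply: ler_sum => i _; rewrite normrM -mulrA ler_wpM2l//.
rewrite ger0_norm ?exprn_ge0//.
case: (i : nat) => [|n].
  by rewrite expr0 fact0 mul1r (le_trans _ (expR_ge1Dx y))// lerDl.
rewrite mulrC -ler_pdivrMr ?ltr0n ?fact_gt0//.
by rewrite (le_trans _ (expR_ge1Dxn n y0))// lerDr.
Qed.

(** For [p = 1] this is the classical smooth function that is flat at 0. The polynomial factor in
    [x^-1] makes the family stable under differentiation. *)
Definition flat p x : R := if 0 < x then p.[x^-1] * expR (- x^-1) else 0.

Lemma flat_le0 p x : x <= 0 -> flat p x = 0.
Proof. by rewrite /flat ltNge => ->. Qed.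

Lemma flat_bounded p : exists2 C, 0 <= C & forall x, `|flat p x| <= C.
Proof.
have [C C0 pC] := horner_le_expR p; exists C => // x.
rewrite /flat; case: ifPn => [x0|_]; last by rewrite normr0.
rewrite normrM (ger0_norm (expR_ge0 _)) expRN ler_pdivrMr ?expR_gt0//.
by rewrite pC// invr_ge0 ltW.
Qed.

(** Extracts a factor [x ^+ 2] in front of a bounded function, so that the difference quotient at 0
    is [O(h)]. *)
Lemma flat_mulX2 p x : flat p x = x ^+ 2 * flat ('X^2 * p) x.
Proof.
rewrite /flat; case: ifPn => [x0|_]; last by rewrite mulr0.
by rewrite hornerM hornerXn exprVn -[X in _ = _ * X]mulrA mulVKf// expf_neq0// gt_eqF.
Qed.

Lemma is_derive_flat p x :
  is_derive x 1 (flat p) (flat ('X^2 * (p - p^`())) x).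
Proof.
have [x0|x0|->] := ltgtP x 0.
- rewrite (flat_le0 _ (ltW x0)).
  apply: (@near_eq_is_derive _ _ _ (cst 0)).
  by near=> y; rewrite /= flat_le0// ltW//; near: y; exact: lt_nbhsl.
- apply: (@near_eq_is_derive _ _ _
      ((horner p \o @GRing.inv R) * (expR \o (fun y => - y^-1)))).
    by near=> y; rewrite /flat ifT//; near: y; exact: lt_nbhsr.
  have dV : is_derive x 1 (@GRing.inv R) (- x ^- 2).
    have := @is_deriveV R id x 1 1 (lt0r_neq0 x0) (is_derive_id _ _).
    by rewrite /GRing.scale/= mulr1.
  have dN : is_derive x 1 (fun y : R => - y^-1) (x ^- 2).
    by rewrite -[X in is_derive _ _ _ X]opprK; exact: is_deriveN.
  have d1 := is_derive1_comp (is_derive_poly p x^-1) dV.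
  have d2 := @is_derive1_comp _ expR (fun y : R => - y^-1) x _ _
    (is_derive_expR (- x^-1)) dN.
  apply: is_derive_eq (is_deriveM d1 d2) _.
  rewrite /flat x0 /GRing.scale/= hornerM hornerXn hornerD hornerN exprVn.
  by lra.
- rewrite flat_le0//.
  have [C C0 pC] := flat_bounded ('X^2 * p).
  have cvg0 : h^-1 *: (flat p (h + 0) - flat p 0) @[h --> (0 : R)^'] --> (0 : R).
    apply/cvgr0Pnorm_le => /= e e0; near=> h.
    have h0 : h != 0 by near: h; exact: nbhs_dnbhs_neq.
    rewrite addr0 (flat_le0 _ (lexx 0)) subr0 flat_mulX2 /GRing.scale/=.
    rewrite expr2 mulrA mulrA mulVf// mul1r normrM.
    rewrite (@le_trans _ _ (`|h| * C))// ?ler_wpM2l//.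
    (* The bound [C] may be zero; [C + 1] is positive and can be divided by. *)
    rewrite (@le_trans _ _ (`|h| * (C + 1)))// ?ler_wpM2l ?lerDl//.
    rewrite -ler_pdivlMr ?ltr_wpDl//.
    by near: h; apply: dnbhs0_le; rewrite divr_gt0// ltr_wpDl.
  apply: DeriveDef.
    apply/cvg_ex; exists 0; move: cvg0.
    by under eq_fun do rewrite -[X in flat p (X + 0)]mulr1.
  rewrite /derive; apply/cvg_lim; first exact: Rhausdorff.
  by move: cvg0; under eq_fun do rewrite -[X in flat p (X + 0)]mulr1.
Unshelve. all: by end_near. Qed.

(* Closed under derivation, so that its members are smooth. *)
Inductive flat_algebra : (R -> R) -> Prop :=
| flat_algebra_flat p a b : flat_algebra (fun x => flat p (a * x + b))
| flat_algebra_cst a : flat_algebra (cst a)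
| flat_algebraD f g : flat_algebra f -> flat_algebra g -> flat_algebra (f + g)
| flat_algebraM f g : flat_algebra f -> flat_algebra g -> flat_algebra (f * g).

Lemma flat_algebra_derive f : flat_algebra f ->
  exists2 g, flat_algebra g & forall x, is_derive x 1 f (g x).
Proof.
elim=> {f} [p a b|a|f g sf [f' sf' df] sg [g' sg' dg]|
            f g sf [f' sf' df] sg [g' sg' dg]].
- exists ((fun x => flat ('X^2 * (p - p^`())) (a * x + b)) * cst a).
    by apply: flat_algebraM; [exact: flat_algebra_flat|exact: flat_algebra_cst].
  move=> x; apply: (@is_derive1_comp _ (flat p) (fun y => a * y + b) x _ a).
    exact: is_derive_flat.
  have := is_deriveD (is_deriveZ a (is_derive_id x (1 : R))) (is_derive_cst b x (1 : R)).
  by rewrite /GRing.scale/= mulr1 addr0.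
- by exists (cst 0); [exact: flat_algebra_cst|move=> x; exact: is_derive_cst].
- by exists (f' + g'); [exact: flat_algebraD|move=> x; exact: is_deriveD].
- exists (f * g' + g * f').
    by apply: flat_algebraD; exact: flat_algebraM.
  by move=> x; exact: is_deriveM.
Qed.

Lemma flat_algebra_smooth f : flat_algebra f -> smooth f.
Proof.
move=> sf n x; suff /flat_algebra_derive[g _ /(_ x)[]//] : flat_algebra (derive1n n f).
elim: n => [//|n /flat_algebra_derive[g sg dg]]; rewrite derive1nS.
rewrite (_ : derive1 _ = g)//; apply/funext => y; rewrite derive1E.
by have [_ ->] := dg y.
Qed.

(** A smooth approximation from below of the indicator of []a, b[], vanishing outside that interval
    for every [n]; steepness grows with [n]. *)
Definition cutoff a b (n : nat) x := flat 1 (n%:R * (x - a)) * flat 1 (n%:R * (b - x)).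

Lemma flat_algebra_cutoff a b n : flat_algebra (cutoff a b n).
Proof.
rewrite (_ : cutoff a b n = (fun x => flat 1 (n%:R * x + - n%:R * a)) *
   (fun x => flat 1 (- n%:R * x + n%:R * b))).
  by apply: flat_algebraM; exact: flat_algebra_flat.
apply/funext => x; rewrite /cutoff; congr (flat _ _ * flat _ _); lra.
Qed.

Lemma cutoff_out a b n x : x \notin `]a, b[ -> cutoff a b n x = 0.
Proof.
rewrite in_itv/= negb_and -!leNgt /cutoff => /orP[xa|bx].
  by rewrite flat_le0 ?mul0r// mulr_ge0_le0// subr_le0.
by rewrite [X in _ * X]flat_le0 ?mulr0// mulr_ge0_le0// subr_le0.
Qed.

Lemma flat1_ge0 x : 0 <= flat 1 x.
Proof. by rewrite /flat; case: ifP => // _; rewrite hornerC mul1r expR_ge0. Qed.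

Lemma flat1_le1 x : flat 1 x <= 1.
Proof.
rewrite /flat; case: ifPn => // x0.
by rewrite hornerC mul1r expR_le1 lerNl oppr0 invr_ge0 ltW.
Qed.

Lemma cutoff_ge0 a b n x : 0 <= cutoff a b n x.
Proof. by rewrite mulr_ge0 ?flat1_ge0. Qed.

Lemma cutoff_le1 a b n x : cutoff a b n x <= 1.
Proof. by rewrite mulr_ile1 ?flat1_ge0 ?flat1_le1. Qed.

Lemma flat1_cvg1 x : 0 < x -> flat 1 (n%:R * x) @[n --> \oo] --> (1 : R).
Proof.
(* The index 0 is skipped, because the exponential formula for [flat] holds only at positive
   arguments. *)
move=> x0; rewrite -(@cvg_shiftS _ (fun n => flat 1 (n%:R * x))).
have -> : (fun n => flat 1 (n.+1%:R * x)) = (fun n : nat => expR (- x^-1 * harmonic n)).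
  apply/funext => n; rewrite /flat mulr_gt0 ?ltr0n// hornerC mul1r.
  by rewrite invfM mulNr mulrC.
have xn0 : (- x^-1 * harmonic n) @[n --> \oo] --> - x^-1 * 0.
  by apply: cvgM; [exact: cvg_cst|exact: cvg_harmonic].
have := cvg_comp _ _ xn0 (@continuous_expR R (- x^-1 * 0)).
by rewrite mulr0 expR0.
Qed.

Lemma cutoff_cvg a b x : x \in `]a, b[ -> cutoff a b n x @[n --> \oo] --> (1 : R).
Proof.
rewrite in_itv/= => /andP[ax xb].
have xa : flat 1 (n%:R * (x - a)) @[n --> \oo] --> (1 : R).
  by apply: flat1_cvg1; rewrite subr_gt0.
have bx : flat 1 (n%:R * (b - x)) @[n --> \oo] --> (1 : R).
  by apply: flat1_cvg1; rewrite subr_gt0.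
rewrite /cutoff.
have := cvgM xa bx.
rewrite (mulr1 (1 : R)).
exact.
Qed.

End smooth_cutoff.

(** * Integrals of products and of almost everywhere equal functions *)

Section integral_facts.
Context d (T : measurableType d) (R : realType).
Variable mu : {measure set T -> \bar R}.
Implicit Types (D : set T) (f g h : T -> R).

Lemma integrable_boundedM D g h C : measurable D ->
  mu.-integrable D (EFin \o g) -> measurable_fun D h ->
  (forall x, D x -> `|h x| <= C) ->
  mu.-integrable D (EFin \o (fun x => g x * h x)).
Proof.
move=> mD ig mh hC; have mg : measurable_fun D g.
  exact/measurable_EFinP/(measurable_int mu).
apply: (@le_integrable _ _ _ mu D mD _ (fun x => (C * g x)%:E)).
- exact/measurable_EFinP/measurable_funM.
- move=> x Dx /=; rewrite lee_fin !normrM mulrC ler_wpM2r//.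
  by rewrite (le_trans (hC x Dx))// ler_norm.
- exact: (integrableZl mD C ig).
Qed.

Lemma eq0_Rintegral D f : (forall x, D x -> f x = 0) -> \int[mu]_(x in D) f x = 0.
Proof.
move=> f0; rewrite (@eq_Rintegral _ _ _ mu D (cst 0)) => [|x /set_mem/f0//].
by rewrite /Rintegral integral0.
Qed.

Lemma ae_eq_Rintegral D f g : measurable D -> measurable_fun D f ->
  measurable_fun D g -> {ae mu, forall x, D x -> f x = g x} ->
  \int[mu]_(x in D) f x = \int[mu]_(x in D) g x.
Proof.
move=> mD mf mg fg; congr fine; apply: ae_eq_integral => //.
- exact/measurable_EFinP.
- exact/measurable_EFinP.
- by apply: filterS fg => x fgx Dx; rewrite fgx.
Qed.

End integral_facts.
Arguments integrable_boundedM {d T R} mu {D g h} C.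

(** * Test functions on an open interval and their primitives *)

Section test_functions.
Variable R : realType.
Local Notation mu := (@lebesgue_measure R).
Implicit Types (f phi psi : R -> R) (l r a b x : R).

Lemma smooth_derivable f x : smooth f -> derivable f x 1.
Proof. by move=> /(_ 0%N). Qed.

Lemma smooth_continuous f : smooth f -> continuous f.
Proof.
move=> sf x; apply/differentiable_continuous; rewrite -derivable1_diffP.
exact: smooth_derivable.
Qed.

Lemma smooth_derive1 f : smooth f -> smooth (derive1 f).
Proof. by move=> sf n x; have := sf n.+1 x; rewrite /derive1n iterSr. Qed.

Lemma smooth_primitive f : (forall x, derivable f x 1) -> smooth (derive1 f) ->
  smooth f.
Proof.
move=> df sf' [|n] x; first exact: df.
by rewrite /derive1n iterSr; exact: sf'.
Qed.

Lemma supported_integrable a b psi : continuous psi ->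
  (forall x, x \notin `]a, b[ -> psi x = 0) ->
  mu.-integrable setT (EFin \o psi).
Proof.
move=> cpsi psi0; rewrite (_ : psi = psi \_ `[a, b]); last first.
  apply/funext => x; rewrite patchE; case: ifPn => // /negP xab.
  rewrite psi0//; apply/negP => xab'; apply: xab; apply/mem_set.
  exact: subset_itv_oo_cc.
rewrite -restrict_EFin -integrable_mkcond//.
apply: continuous_compact_integrable; first exact: segment_compact.
exact: continuous_subspaceT.
Qed.

(** The margins [l < a] and [b < r] keep the closure of the support, contained in [[a, b]], inside
    the open interval. *)
Lemma test_function_support l r a b psi : l < a -> b < r -> smooth psi ->
  (forall x, x \notin `]a, b[ -> psi x = 0) -> test_function `]l, r[ psi.
Proof.
move=> la br spsi psi0.
have sub : support_of psi `<=` `[a, b].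
  have : closed `[a, b] by exact: itv_closed.
  move/closure_id => ->; apply: closureS => x /= /eqP psix.
  by apply: subset_itv_oo_cc; apply: contra_notT psix => /psi0.
split=> //.
- apply: (subclosed_compact _ (@segment_compact _ a b) sub).
  exact: closed_closure.
- by apply: (subset_trans sub); apply: subset_itv; rewrite bnd_simp.
Qed.

Lemma test_function_out l r phi x : test_function `]l, r[ phi ->
  x \notin `]l, r[ -> phi x = 0.
Proof.
move=> [_ _ sub] xlr; apply/eqP; apply: contraNT xlr => phix.
by apply: sub; exact: subset_closure.
Qed.

(** The primitive from [-oo] vanishes to the left of [a], and to the right of [b] it equals the
    total integral of [psi], which is zero. *)
Lemma test_function_primitive l r a b psi : l < a -> b < r -> smooth psi ->
  (forall x, x \notin `]a, b[ -> psi x = 0) -> \int[mu]_(x in `]l, r[) psi x = 0 ->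
  exists2 phi, test_function `]l, r[ phi & derive1 phi = psi.
Proof.
move=> la br spsi psi0 intpsi.
have cpsi := smooth_continuous spsi.
have ipsi := supported_integrable cpsi psi0.
pose phi x := \int[mu]_(t in `]-oo, x]) psi t.
have dphi x : derivable phi x 1 /\ derive1 phi x = psi x.
  apply: (@continuous_FTC1 _ psi -oo%O x (x + 1)) => //.
  - by rewrite ltrDl.
  - exact: integrableS ipsi.
  - by rewrite ltNyr.
  - exact: cpsi.
have phi' : derive1 phi = psi by rewrite funeqE => y; exact: (dphi y).2.
exists phi => //; apply: (test_function_support la br).
- by apply: smooth_primitive => [x|]; [exact: (dphi x).1|rewrite phi'].
- move=> x; rewrite in_itv/= negb_and -!leNgt => /orP[xa|bx].
    apply: eq0_Rintegral => t /=; rewrite in_itv/= => tx; apply: psi0.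
    by rewrite in_itv/= negb_and -!leNgt (le_trans tx).
  rewrite -intpsi /phi Rintegral_mkcond [RHS]Rintegral_mkcond.
  congr (Rintegral _ _ _); apply/funext => t; rewrite !patchE.
  have [tab|tab] := boolP (t \in `]a, b[); last by rewrite psi0// !if_same.
  move: tab; rewrite in_itv/= => /andP[at_ tb].
  rewrite !mem_set//= in_itv/=; last exact: (le_trans (ltW tb)).
  by rewrite (lt_trans la)// (lt_trans tb).
Qed.

End test_functions.

(** * The du Bois-Reymond lemma: a function with zero distributional derivative is constant a.e *)

Section du_bois_reymond.
Variable R : realType.
Local Notation mu := (@lebesgue_measure R).
Implicit Types (g h phi psi : R -> R) (l r a b c d x : R) (D : set R).

Lemma cutoff_continuous a b (n : nat) : continuous (cutoff a b n).
Proof. exact/smooth_continuous/flat_algebra_smooth/flat_algebra_cutoff. Qed.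

Lemma cutoff_measurable a b (n : nat) D : measurable_fun D (cutoff a b n).
Proof.
apply: measurable_funTS; apply: continuous_measurable_fun.
exact: cutoff_continuous.
Qed.

Lemma cutoff_norm_le1 a b (n : nat) x : `|cutoff a b n x| <= 1.
Proof. by rewrite ger0_norm ?cutoff_ge0// cutoff_le1. Qed.

(** Dominated convergence with [|g|] as the dominating function. *)
Lemma cutoff_integral_cvg D g a b : measurable D ->
  mu.-integrable D (EFin \o g) -> `]a, b[ `<=` D ->
  \int[mu]_(x in D) (g x * cutoff a b n x) @[n --> \oo] -->
  \int[mu]_(x in `]a, b[) g x.
Proof.
move=> mD ig abD.
have mg : measurable_fun D g by apply/measurable_EFinP; exact: (measurable_int mu ig).
have igb n := integrable_boundedM mu 1 mD ig (@cutoff_measurable a b n D)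
  (fun x _ => cutoff_norm_le1 a b n x).
have -> : \int[mu]_(x in `]a, b[) g x = \int[mu]_(x in D) (g \_ `]a, b[) x.
  by rewrite -Rintegral_mkcondr setIidr.
have mgab : measurable_fun D (g \_ `]a, b[).
  by apply/measurable_restrict => //; exact: measurable_funS mg.
have igab : mu.-integrable D (EFin \o g \_ `]a, b[).
  apply: (@le_integrable _ _ _ mu D mD _ (EFin \o g)) => //.
    exact/measurable_EFinP.
  move=> x Dx /=; rewrite lee_fin patchE; case: ifPn => // _.
  by rewrite normr0.
pose f_ n x := (g x * cutoff a b n x)%:E.
have cvgf : {ae mu, forall x, D x ->
    f_ n x @[n --> \oo] --> (EFin \o g \_ `]a, b[) x}.
  apply: aeW => x Dx; apply/cvg_EFin; first exact: nearW.
  rewrite /comp /= patchE; case: ifPn => xab.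
    have /cutoff_cvg gx : x \in `]a, b[ by move/set_mem : xab.
    have := cvgM (cvg_cst (g x)) gx; rewrite (mulr1 (g x)) => cg; exact: cg.
  have -> : (fun n => g x * cutoff a b n x) = cst 0.
    apply/funext => n; rewrite cutoff_out ?mulr0//.
    by apply: contra xab => xab; apply/mem_set.
  exact: cvg_cst.
have domf : {ae mu, forall x n, D x -> (`|f_ n x| <= `|(g x)%:E|)%E}.
  apply: aeW => x n Dx /=; rewrite lee_fin normrM -[leRHS]mulr1 ler_wpM2l//.
  exact: cutoff_norm_le1.
have [_ _ cvgfg] := @dominated_convergence _ (measurableTypeR R) R mu D mD
  f_ (EFin \o g \_ `]a, b[) (fun x => `|(g x)%:E|)%E (fun n => measurable_int mu (igb n))
  (measurable_int mu igab) cvgf (integrable_abse ig) domf.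
apply: fine_cvg.
rewrite fineK; last exact: integrable_fin_num.
exact: cvgfg.
Qed.

Section constant.
Variables (l r : R) (h : R -> R).
Hypothesis lr : l < r.
Hypothesis ih : mu.-integrable `]l, r[ (EFin \o h).
Hypothesis h_orth : forall phi, test_function `]l, r[ phi ->
  \int[mu]_(x in `]l, r[) (h x * derive1 phi x) = 0.

Lemma itv_integrable_cst (k a b : R) : mu.-integrable `]a, b[ (EFin \o cst k).
Proof.
apply: measurable_bounded_integrable => //.
- by rewrite /= lebesgue_measure_itv/=; case: ifP => // _; rewrite -EFinB ltry.
- by exists `|k|; split => // M kM x _ /=; exact: ltW.
Qed.

(** A combination of two cutoffs with zero mean is the derivative of a test function, hence
    orthogonal to [h]. In the limit the cutoffs become indicators, so [h] has the same average on
    both intervals. *)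
Lemma orthogonal_itv a b c d : l < a -> a < b -> b < r -> l < c -> c < d -> d < r ->
  (d - c) * \int[mu]_(x in `]a, b[) h x = (b - a) * \int[mu]_(x in `]c, d[) h x.
Proof.
move=> la ab br lc cd dr.
have mD : measurable (`]l, r[ : set (measurableTypeR R)) by [].
have i1 := itv_integrable_cst 1 l r.
have abD : `]a, b[ `<=` `]l, r[ by apply: subset_itv; rewrite bnd_simp ltW.
have cdD : `]c, d[ `<=` `]l, r[ by apply: subset_itv; rewrite bnd_simp ltW.
have int1 u v : u < v -> \int[mu]_(x in `]u, v[) cst (1 : R) x = v - u.
  move=> uv; rewrite Rintegral_cst//= mul1r lebesgue_measure_itv/= lte_fin uv.
  by rewrite -EFinB.
pose A n := \int[mu]_(x in `]l, r[) (cst 1 x * cutoff a b n x).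
pose B n := \int[mu]_(x in `]l, r[) (cst 1 x * cutoff c d n x).
pose hA n := \int[mu]_(x in `]l, r[) (h x * cutoff a b n x).
pose hB n := \int[mu]_(x in `]l, r[) (h x * cutoff c d n x).
have AE : A n @[n --> \oo] --> b - a.
  by rewrite -(int1 _ _ ab); exact: cutoff_integral_cvg.
have BE : B n @[n --> \oo] --> d - c.
  by rewrite -(int1 _ _ cd); exact: cutoff_integral_cvg.
have hAE := cutoff_integral_cvg mD ih abD.
have hBE := cutoff_integral_cvg mD ih cdD.
have eqn n : B n * hA n = A n * hB n.
  (* The coefficients are the integrals of the opposite cutoffs, which makes the integral of [psi]
     equal to [A n * B n - A n * B n = 0]. *)
  pose psi := (cst (B n) * cutoff a b n) + (cst (- A n) * cutoff c d n) : R -> R.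
  have spsi : smooth psi.
    apply: flat_algebra_smooth; apply: flat_algebraD; apply: flat_algebraM;
      by [exact: flat_algebra_cst|exact: flat_algebra_cutoff].
  have psi0 x : x \notin `]Num.min a c, Num.max b d[ -> psi x = 0.
    move=> xabcd; rewrite /psi !fctE !cutoff_out ?mulr0 ?addr0//.
      apply: contra xabcd; rewrite !in_itv/= => /andP[cx xd].
      by rewrite gt_min cx orbT lt_max xd orbT.
    apply: contra xabcd; rewrite !in_itv/= => /andP[ax xb].
    by rewrite gt_min ax lt_max xb.
  have ib g u v : mu.-integrable `]l, r[ (EFin \o g) ->
      mu.-integrable `]l, r[ (EFin \o (fun x => g x * cutoff u v n x)).
    move=> ig; apply: (integrable_boundedM mu 1 mD ig (@cutoff_measurable u v n _)).
    by move=> x _; exact: cutoff_norm_le1.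
  have intpsi g : mu.-integrable `]l, r[ (EFin \o g) ->
      \int[mu]_(x in `]l, r[) (g x * psi x) =
      B n * \int[mu]_(x in `]l, r[) (g x * cutoff a b n x) -
      A n * \int[mu]_(x in `]l, r[) (g x * cutoff c d n x).
    move=> ig; rewrite -RintegralZl//; last exact: ib.
    rewrite -RintegralZl//; last exact: ib.
    rewrite -RintegralB//; last 2 first.
      exact: (integrableZl mD (B n) (ib _ a b ig)).
      exact: (integrableZl mD (A n) (ib _ c d ig)).
    by apply: eq_Rintegral => x _; rewrite /psi !fctE; lra.
  have psi1 : \int[mu]_(x in `]l, r[) psi x = 0.
    under eq_Rintegral do rewrite -[psi _]mul1r.
    by rewrite (intpsi (cst 1) i1) -/(A n) -/(B n) mulrC subrr.
  have minl : l < Num.min a c by rewrite lt_min la.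
  have maxr : Num.max b d < r by rewrite gt_max br.
  have [phi tphi phi'] := test_function_primitive minl maxr spsi psi0 psi1.
  by have := h_orth tphi; rewrite phi' (intpsi _ ih) => /eqP; rewrite subr_eq0 => /eqP.
have cvg1 : (B n * hA n) @[n --> \oo] --> (d - c) * \int[mu]_(x in `]a, b[) h x.
  exact: cvgM.
have cvg2 : (A n * hB n) @[n --> \oo] --> (b - a) * \int[mu]_(x in `]c, d[) h x.
  exact: cvgM.
rewrite -(cvg_lim (@Rhausdorff R) cvg1) -(cvg_lim (@Rhausdorff R) cvg2).
by under eq_fun do rewrite eqn.
Qed.

(** With [K] the average of [h] over a fixed inner interval, all inner intervals have average [K] by
    [orthogonal_itv]. The primitive of [h - K] is therefore constant, and Lebesgue differentiation
    gives [h = K] a.e. *)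
Lemma orthogonal_ae_cst :
  exists K, {ae mu, forall x, `]l, r[%classic x -> h x = K}.
Proof.
(* The middle third of []l, r[] serves as the reference interval. *)
pose c := (2 * l + r) / 3; pose d := (l + 2 * r) / 3.
have lc : l < c by rewrite /c; move: lr; lra.
have cd : c < d by rewrite /c /d; move: lr; lra.
have dr : d < r by rewrite /d; move: lr; lra.
pose K := \int[mu]_(x in `]c, d[) h x / (d - c); exists K.
have mD : measurable (`]l, r[ : set (measurableTypeR R)) by [].
(* Extension by zero makes the primitive from [-oo] available on the whole line. *)
pose k := (fun x => h x - K) \_ `]l, r[.
have ik' : mu.-integrable `]l, r[ (EFin \o (fun x => h x - K)).
  exact: (integrableB mD ih (itv_integrable_cst K l r)).
have ik : mu.-integrable setT (EFin \o k).
  by rewrite /k -restrict_EFin -integrable_mkcond.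
pose F x := \int[mu]_(t in `]-oo, x]) k t.
have Fcst x y : l < x -> x < y -> y < r -> F y = F x.
  move=> lx xy yr; apply/eqP; rewrite -subr_eq0; apply/eqP.
  rewrite Rintegral_itvB//; last 2 first.
    by apply: integrableS ik.
    by rewrite bnd_simp ltW.
  have sub : `]x, y[ `<=` `]l, r[ by apply: subset_itv; rewrite bnd_simp ltW.
  rewrite -Rintegral_itv_bndo_bndc; last exact: integrableS ik.
  transitivity (\int[mu]_(t in `]x, y[) (h t - cst K t)).
    by apply: eq_Rintegral => t /set_mem/sub tlr; rewrite /k patchE mem_set.
  rewrite RintegralB//; last 2 first.
    exact: integrableS ih.
    exact: itv_integrable_cst.
  rewrite Rintegral_cst//= lebesgue_measure_itv/= lte_fin xy -EFinB/=.
  apply/eqP; rewrite subr_eq0; apply/eqP.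
  have dc0 : d - c != 0 by rewrite subr_eq0 gt_eqF.
  apply: (mulfI dc0); rewrite (orthogonal_itv lx xy yr lc cd dr).
  by rewrite /K mulrA [_ * (_ / _)]mulrC divfK// mulrC.
have locf : locally_integrable setT k.
  by apply: open_integrable_locally => //; exact: openT.
have ikN y : mu.-integrable `]-oo, y] (EFin \o k) by exact: integrableS ik.
have := FTC1Ny ikN locf.
apply: filterS; first exact: (ae_filter_ringOfSetsType mu).
move=> x [_ F'k] lrx.
have : k x = 0.
  rewrite -F'k derive1E.
  (* Near an interior point [F] coincides with a constant, so its derivative is 0. *)
  rewrite (@near_eq_derive _ _ _ _ (cst (F x))) ?derive_cst//.
  move: lrx; rewrite /= in_itv/= => /andP[lx xr].
  near=> y.
  have ly : l < y by near: y; exact: lt_nbhsr.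
  have yr : y < r by near: y; exact: lt_nbhsl.
  have [xy|yx|->//] := ltgtP x y; first exact: Fcst.
  by rewrite /= (Fcst y x).
by rewrite /k patchE mem_set// => /eqP; rewrite subr_eq0 => /eqP.
Unshelve. all: by end_near. Qed.

End constant.
End du_bois_reymond.

(** * Fubini for the cumulative function of a finite measure *)

Section cumulative.
Variable R : realType.
Local Notation mu := (@lebesgue_measure R).
Local Notation TR := (measurableTypeR R).
Variable m : {finite_measure set TR -> \bar R}.
Variables (l r : R) (g : R -> R).
Hypothesis ig : mu.-integrable `]l, r[ (EFin \o g).

Let D : set TR := `]l, r[.
Let mD : measurable D. Proof. exact: measurable_itv. Qed.

(** The Fubini kernel: integration in the second variable gives [g x] times the measure of []l, x]],
    integration in the first one gives the integral of [g] over [[y, r[]. *)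
Let f (z : TR * TR) : \bar R :=
  (if (l < z.2) && (z.2 <= z.1) then (g \_ D) z.1 else 0)%:E.

Let mgD : measurable_fun setT (g \_ D : TR -> R).
Proof.
apply: (measurable_restrictT g mD).1; apply/measurable_EFinP.
exact: (measurable_int mu ig).
Qed.

Let mf : measurable_fun setT f.
Proof.
apply/measurable_EFinP.
apply: measurable_fun_ifT => //.
- apply: measurable_and.
    by apply: measurable_fun_ltr => //; exact: measurable_snd.
  by apply: measurable_fun_ler; [exact: measurable_snd|exact: measurable_fst].
- by apply: measurableT_comp mgD _; exact: measurable_fst.
Qed.

Let fE1 x y : f (x, y) = (((g \_ D) x)%:E * (\1_(`]l, x]%classic : set TR) y)%:E)%E.
Proof.
rewrite /f/= indicE -EFinM; congr EFin.
case: ifPn => xy; first by rewrite mem_set ?mulr1.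
by rewrite memNset ?mulr0// => /= /[!in_itv]; apply/negP.
Qed.

Let int_cst_indic c x :
  (\int[m]_y (c%:E * (\1_(`]l, x]%classic : set TR) y)%:E) =
   (c * fine (m `]l, x]%classic))%:E)%E.
Proof.
rewrite integralZl//; last first.
  apply: (@measurable_bounded_integrable _ _ _ m) => //.
  - by rewrite ltey_eq fin_num_measure.
  - exists 1; split => // M M1 y _; rewrite /= indicE.
    by rewrite ger0_norm// (le_trans _ (ltW M1))// lern1 leq_b1.
by rewrite integral_indic// setIT EFinM fineK// fin_num_measure.
Qed.

Let intf1 x : (\int[m]_y f (x, y) = ((g \_ D) x * fine (m `]l, x]%classic))%:E)%E.
Proof. by under eq_integral do rewrite fE1; exact: int_cst_indic. Qed.

Let fE2 y x : f (x, y) = if y \in D then ((EFin \o g) \_ `[y, r[) x else 0%E.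
Proof.
rewrite /f/=; have [yD|yD] := boolP (y \in D).
  move/set_mem : (yD); rewrite /D/= in_itv/= => /andP[ly yr].
  rewrite ly/= !patchE; case: ifPn => yx.
    have [xr|xr] := ltP x r.
      by rewrite !mem_set//= in_itv/= xr andbT// (lt_le_trans ly yx).
    by rewrite !memNset//= in_itv/= => /andP[_]; rewrite ltNge xr.
  by case: ifPn => // /set_mem; rewrite /= in_itv/= (negbTE yx).
case: ifPn => // /andP[ly yx]; rewrite patchE memNset//.
rewrite /D/= in_itv/= => /andP[_ xr].
move: yD => /negP; apply; apply/mem_set; rewrite /D/= in_itv/= ly.
exact: le_lt_trans xr.
Qed.

Let igy y : D y -> mu.-integrable `[y, r[ (EFin \o g).
Proof.
rewrite /D/= in_itv/= => /andP[ly yr]; apply: integrableS ig => //.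
by apply: subset_itv => //; rewrite bnd_simp.
Qed.

Let intf2 y :
  (\int[mu]_x f (x, y) = if y \in D then (\int[mu]_(x in `[y, r[) g x)%:E else 0)%E.
Proof.
under eq_integral do rewrite fE2.
case: ifPn => yD; last by rewrite integral0.
rewrite -integral_mkcond /Rintegral fineK//.
by apply: integrable_fin_num => //; apply: igy; exact: set_mem.
Qed.

Let iF : mu.-integrable setT (fun x => ((g \_ D) x * fine (m `]l, x]%classic))%:E).
Proof.
have ig' : mu.-integrable setT (EFin \o g \_ D).
  by rewrite -restrict_EFin -integrable_mkcond.
apply: (integrable_boundedM mu (fine (m setT)) measurableT ig').
- apply: nondecreasing_measurable => // x y xy.
  rewrite fine_le ?fin_num_measure// le_measure ?inE//.
  by apply: subset_itvl; rewrite bnd_simp.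
- move=> x _; rewrite ger0_norm ?fine_ge0//.
  by rewrite fine_le ?fin_num_measure// le_measure ?inE.
Qed.

Let imf : (mu \x m)%E.-integrable setT f.
Proof.
apply/integrable12ltyP => //.
(* The integral of [|f (x, y)|] in [y] is the absolute value of the integrand of [iF], whose
   integral is finite. *)
move/integrableP : iF => [_]; congr (_ < _)%E; apply: eq_integral => x _ /=.
rewrite normrM (ger0_norm (fine_ge0 _))// -int_cst_indic.
apply: eq_integral => y _.
rewrite -[RHS]/(`|f (x, y)|%E) fE1 abseM/=; congr (_ * _)%E.
by rewrite indicE ger0_norm.
Qed.

Let igC y : D y -> `|\int[mu]_(x in `[y, r[) g x| <= \int[mu]_(x in D) `|g x|.
Proof.
move=> Dy; rewrite (le_trans (le_normr_Rintegral _ (igy Dy)))//.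
have sub : `[y, r[ `<=` D.
  move: Dy; rewrite /D/= in_itv/= => /andP[ly yr].
  by apply: subset_itv => //; rewrite bnd_simp.
have ign := integrable_norm ig.
rewrite fine_le//.
- by apply: integrable_fin_num => //; exact: integrableS ign.
- exact: integrable_fin_num ign.
- apply: ge0_subset_integral => //; exact: (measurable_int mu ign).
Qed.

Lemma integrable_cumulative :
  mu.-integrable `]l, r[ (EFin \o (fun x => g x * fine (m `]l, x]%classic))).
Proof.
apply: (@eq_integrable _ _ _ mu _ mD
  (fun x => ((g \_ D) x * fine (m `]l, x]%classic))%:E)) => [x xD|].
  by rewrite patchE xD.
exact: integrableS iF.
Qed.

(** Measurability in [y] comes from Fubini, the tail being a partial integral of the kernel [f]; the
    bound is the L1 norm of [g]. *)
Lemma integrable_tail :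
  m.-integrable `]l, r[ (EFin \o (fun y => \int[mu]_(x in `[y, r[) g x)).
Proof.
apply: measurable_bounded_integrable => //.
- by rewrite ltey_eq fin_num_measure.
- have : measurable_fun D (fubini_G mu f).
    by apply: measurable_funTS; exact: (measurable_fubini_G imf).
  move=> mG; apply/measurable_EFinP; apply: eq_measurable_fun mG => y yD.
  by rewrite /fubini_G intf2 yD.
- exists (\int[mu]_(x in D) `|g x|); split; first exact: num_real.
  move=> M /ltW CM y Dy /=.
  exact: le_trans (igC Dy) CM.
Qed.

Lemma Rintegral_cumulative :
  \int[mu]_(x in `]l, r[) (g x * fine (m `]l, x]%classic)) =
  \int[m]_(y in `]l, r[) \int[mu]_(x in `[y, r[) g x.
Proof.
transitivity (fine (\int[mu]_x \int[m]_y f (x, y))%E).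
  rewrite Rintegral_mkcond; congr fine; apply: eq_integral => x _.
  by rewrite intf1 !patchE; case: ifP => //; rewrite mul0r.
rewrite (Fubini imf) [RHS]Rintegral_mkcond; congr fine.
by apply: eq_integral => y _; rewrite intf2 patchE; case: ifP.
Qed.

End cumulative.

(** * Representation of BV functions and the bound of [int g v] by the variation *)

Section pairing.
Variable R : realType.
Local Notation mu := (@lebesgue_measure R).
Local Notation TR := (measurableTypeR R).
Variables (l r : R) (v : R -> R) (nu : {charge set TR -> \bar R}).
Hypothesis lr : l < r.

Let D : set TR := `]l, r[.
Let mD : measurable D. Proof. exact: measurable_itv. Qed.

Let jp : {finite_measure set TR -> \bar R} := jordan_pos (hahn_PN nu).
Let jn : {finite_measure set TR -> \bar R} := jordan_neg (hahn_PN nu).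

Let cumul (m : {finite_measure set TR -> \bar R}) (x : R) : R :=
  fine (m `]l, x]%classic).

(** This is [nu] of []l, x]], as [VE] shows; the splitting into Jordan parts gives monotone pieces
    to which the results for positive measures apply. *)
Let V x := cumul jp x - cumul jn x.

Let mcumul m : measurable_fun D (cumul m).
Proof.
apply: nondecreasing_measurable => // x y xy.
rewrite fine_le ?fin_num_measure// le_measure ?inE//.
by apply: subset_itvl; rewrite bnd_simp.
Qed.

Let cumul_le m x : `|cumul m x| <= fine (m setT).
Proof.
rewrite ger0_norm ?fine_ge0//.
by rewrite fine_le ?fin_num_measure// le_measure ?inE.
Qed.

Let mV : measurable_fun D V.
Proof. by apply: measurable_funB; exact: mcumul. Qed.

Let V_le x : `|V x| <= fine (jp setT) + fine (jn setT).
Proof.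
rewrite (le_trans (ler_normB _ _))// lerD//; exact: cumul_le.
Qed.

Let tail (g : R -> R) y := \int[mu]_(x in `[y, r[) g x.

Lemma cumulative_by_parts g : mu.-integrable D (EFin \o g) ->
  \int[mu]_(x in D) (g x * V x) = cintegral nu D (tail g).
Proof.
move=> ig; rewrite /cintegral -(Rintegral_cumulative jp ig).
rewrite -(Rintegral_cumulative jn ig) -RintegralB//; last 2 first.
- exact: (integrable_cumulative jp ig).
- exact: (integrable_cumulative jn ig).
by apply: eq_Rintegral => x _; rewrite mulrBr.
Qed.

(** The fundamental theorem of calculus on [[y, r]], with [phi r = 0]. *)
Lemma tail_derive1 phi y : test_function `]l, r[ phi -> y < r ->
  tail (derive1 phi) y = - phi y.
Proof.
move=> tphi yr; have [sphi _ _] := tphi.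
have cphi' : continuous (derive1 phi).
  exact/smooth_continuous/smooth_derive1.
have iphi' : mu.-integrable `[y, r] (EFin \o derive1 phi).
  apply: continuous_compact_integrable; first exact: segment_compact.
  exact: continuous_subspaceT.
rewrite /tail Rintegral_itv_bndo_bndc; last first.
  apply: integrableS iphi' => //.
  by apply: subset_itvl; rewrite bnd_simp.
rewrite /Rintegral (@continuous_FTC2 _ (derive1 phi) phi)//.
- by rewrite -EFinB/= (test_function_out tphi) ?sub0r// in_itv/= ltxx andbF.
- exact: continuous_subspaceT.
- split.
  + by move=> x _; exact: smooth_derivable.
  + by apply: cvg_at_right_filter; exact: smooth_continuous.
  + by apply: cvg_at_left_filter; exact: smooth_continuous.
Qed.

Lemma cintegral_eq phi psi : {in D, phi =1 psi} ->
  cintegral nu D phi = cintegral nu D psi.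
Proof.
by move=> e; rewrite /cintegral (eq_Rintegral _ e) (eq_Rintegral _ e).
Qed.

Lemma continuous_bounded_itv (f : R -> R) : continuous f ->
  exists M, forall x, D x -> `|f x| <= M.
Proof.
move=> cf; have cfs : {within `[l, r], continuous f} by exact: continuous_subspaceT.
have /compact_bounded[M [_ fM]] := continuous_compact cfs (@segment_compact _ l r).
(* Boundedness is stated for every number strictly above [M]. *)
exists (M + 1) => x Dx; apply: (fM (M + 1)); first by rewrite ltrDl.
by exists x => //; exact: subset_itv_oo_cc.
Qed.

Let i1 k : mu.-integrable D (EFin \o cst k).
Proof. exact: itv_integrable_cst. Qed.

Let iV : mu.-integrable D (EFin \o V).
Proof.
have := integrable_boundedM mu _ mD (i1 1) mV (fun x _ => V_le x).
by apply: eq_integrable => // x _ /=; rewrite mul1r.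
Qed.

Lemma integrableM_derive1 phi f : test_function `]l, r[ phi ->
  mu.-integrable D (EFin \o f) ->
  mu.-integrable D (EFin \o (fun x => f x * derive1 phi x)).
Proof.
move=> [sphi _ _] intf.
have cphi' : continuous (derive1 phi).
  exact/smooth_continuous/smooth_derive1.
have [M phi'M] := continuous_bounded_itv cphi'.
apply: (integrable_boundedM mu M mD intf) => //.
by apply: measurable_funTS; exact: continuous_measurable_fun.
Qed.

(** Thus [nu] is the distributional derivative of its cumulative function: in [cumulative_by_parts]
    with [g = phi'] the tail is [- phi]. *)
Lemma Rintegral_cumul_derive1 phi : test_function `]l, r[ phi ->
  \int[mu]_(x in D) (V x * derive1 phi x) = - cintegral nu D phi.
Proof.
move=> tphi; have [sphi _ _] := tphi.
have cphi := smooth_continuous sphi.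
have [N phiN] := continuous_bounded_itv cphi.
have iphi (m : {finite_measure set TR -> \bar R}) : m.-integrable D (EFin \o phi).
  apply: measurable_bounded_integrable => //.
  - by rewrite ltey_eq fin_num_measure.
  - by apply: measurable_funTS; exact: continuous_measurable_fun.
  - exists N; split; first exact: num_real.
    by move=> x /ltW Nx y Dy; exact: le_trans (phiN _ Dy) Nx.
under eq_Rintegral do rewrite mulrC.
rewrite cumulative_by_parts; last first.
  have := integrableM_derive1 tphi (i1 1).
  by apply: eq_integrable => // x _ /=; rewrite mul1r.
rewrite (@cintegral_eq _ (fun y => - 1 * phi y)); last first.
  move=> y /set_mem; rewrite /D/= in_itv/= => /andP[_ yr].
  by rewrite tail_derive1// mulN1r.
by rewrite /cintegral !RintegralZl//; [lra|exact: iphi|exact: iphi].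
Qed.

Lemma Rintegral_derive1 phi : test_function `]l, r[ phi ->
  \int[mu]_(x in D) derive1 phi x = 0.
Proof.
move=> tphi; rewrite Rintegral_itv_obnd_cbnd; last first.
  have := integrableM_derive1 tphi (i1 1).
  by apply: eq_integrable => // x _ /=; rewrite mul1r.
rewrite -/(tail _ l) tail_derive1// (test_function_out tphi) ?oppr0//.
by rewrite in_itv/= ltxx.
Qed.

Let VE x : V x = fine (nu `]l, x]%classic).
Proof.
rewrite (jordan_decomp (hahn_PN nu))//= /cadd/= cscaleN1.
by rewrite fineD ?fin_numN ?(fin_num_measure jp)// ?(fin_num_measure jn)// fineN.
Qed.

(** The constant [K] drops out since derivatives of test functions have zero integral. *)
Lemma cumulative_distributional_derivative K :
  (forall x, D x -> v x = fine (nu `]l, x]%classic) + K) ->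
  distributional_derivative `]l, r[ v nu.
Proof.
move=> vE phi tphi; rewrite -Rintegral_cumul_derive1//.
transitivity (\int[mu]_(x in D) (V x * derive1 phi x + K * derive1 phi x)).
  by apply: eq_Rintegral => x /set_mem Dx; rewrite vE// -VE mulrDl.
rewrite RintegralD//; last 2 first.
- exact: integrableM_derive1.
- exact: (integrableM_derive1 tphi (i1 K)).
rewrite RintegralZl// ?Rintegral_derive1 ?mulr0 ?addr0//.
have := integrableM_derive1 tphi (i1 1).
by apply: eq_integrable => // x _ /=; rewrite mul1r.
Qed.

Hypothesis iv : mu.-integrable `]l, r[ (EFin \o v).
Hypothesis dv : distributional_derivative `]l, r[ v nu.

(** Both [v] and [V] have distributional derivative [nu], so the du Bois-Reymond lemma applies to
    [v - V]. *)
Lemma BV_representative : exists K, {ae mu, forall x, D x -> v x = V x + K}.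
Proof.
have ivV : mu.-integrable D (EFin \o (fun x => v x - V x)).
  exact: (integrableB mD iv iV).
have [|K vVK] := orthogonal_ae_cst lr ivV.
  move=> phi tphi.
  transitivity (\int[mu]_(x in D) (v x * derive1 phi x - V x * derive1 phi x)).
    by apply: eq_Rintegral => x _; rewrite mulrBl.
  rewrite RintegralB//; last 2 first.
  - exact: integrableM_derive1.
  - exact: integrableM_derive1.
  by rewrite dv// Rintegral_cumul_derive1// subrr.
exists K; move: vVK; apply: filterS; first exact: (ae_filter_ringOfSetsType mu).
move=> x vVx Dx.
by rewrite -(vVx Dx) addrC subrK.
Qed.

(** Zero mean of [g] removes the constant of the representation of [v]. What remains is the integral
    of the tail of [g] against [nu], and the tail is at most 1 in absolute value, so each Jordan
    part contributes at most its mass. *)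
Lemma pairing_le_variation (g : R -> R) (C : R) : measurable_fun D g ->
  (forall x, D x -> `|g x| <= C) ->
  \int[mu]_(x in D) g x = 0 ->
  (forall y, D y -> `|\int[mu]_(x in `[y, r[) g x| <= 1) ->
  (`|\int[mu]_(x in D) (g x * v x)|%:E <= cvariation nu D)%E.
Proof.
move=> mg gC intg tail1.
have ig : mu.-integrable D (EFin \o g).
  have := integrable_boundedM mu C mD (i1 1) mg gC.
  by apply: eq_integrable => // x _ /=; rewrite mul1r.
have [K vVK] := BV_representative.
have igV : mu.-integrable D (EFin \o (fun x => g x * V x)).
  exact: (integrable_boundedM mu _ mD ig mV (fun x _ => V_le x)).
have -> : \int[mu]_(x in D) (g x * v x) = cintegral nu D (tail g).
  transitivity (\int[mu]_(x in D) (g x * V x + K * g x)).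
    apply: (@ae_eq_Rintegral _ TR R mu) => //.
    - apply: measurable_funM => //; apply/measurable_EFinP.
      exact: (measurable_int mu iv).
    - by apply: measurable_funD; apply: measurable_funM.
    - move: vVK; apply: filterS => x vVx Dx.
      by rewrite vVx// mulrDr (mulrC K).
  rewrite RintegralD//; last exact: (integrableZl mD K ig).
  by rewrite RintegralZl// intg mulr0 addr0 cumulative_by_parts.
rewrite /cvariation /charge_variation/= -/jp -/jn.
have bnd (m : {finite_measure set TR -> \bar R}) :
    `|\int[m]_(y in D) tail g y| <= fine (m D).
  have it := integrable_tail m ig.
  rewrite (le_trans (le_normr_Rintegral mD it))//.
  rewrite -[leRHS]mul1r -Rintegral_cst//; apply: le_Rintegral => //.
  - exact: (integrable_norm it).
  - exact: finite_measure_integrable_cst.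
rewrite -(fineK (fin_num_measure jp D mD)) -(fineK (fin_num_measure jn D mD)).
rewrite -EFinD lee_fin /cintegral (le_trans (ler_normB _ _))// lerD//.
- exact: (bnd jp).
- exact: (bnd jn).
Qed.

End pairing.

(** * The candidate minimizer and its variation *)

Section clamped_linear.
Variable R : realType.
Local Notation mu := (@lebesgue_measure R).
Local Notation TR := (measurableTypeR R).

(** The negative Jordan part is [- nu] on a part of the Hahn negative set, hence zero for a
    nonnegative charge. *)
Lemma cvariation_nonneg (nu : {charge set TR -> \bar R}) (D : set TR) :
  (forall A, measurable A -> (0 <= nu A)%E) -> measurable D ->
  (cvariation nu D <= nu D)%E.
Proof.
move=> nu0 mD; rewrite (jordan_decomp (hahn_PN nu))//= /cadd/= cscaleN1.
have [_ [mN _] _ _] := hahn_PN nu.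
rewrite /cvariation /charge_variation/=.
suff -> : jordan_neg (hahn_PN nu) D = 0%E by rewrite oppe0 !adde0.
apply/eqP; rewrite eq_le measure_ge0 andbT jordan_negE cjordan_negE.
by rewrite /crestr0 mem_set// oppe_le0 nu0//; exact: measurableI.
Qed.

Variables (l r x1 x2 lambda : R).
Hypotheses (lx1 : l < x1) (x12 : x1 <= x2) (x2r : x2 < r) (lambda0 : 0 <= lambda).

Definition clamped_linear x : R :=
  if x < x1 then lambda * x1 else if x <= x2 then lambda * x else lambda * x2.

Let mu12 : mu `[x1, x2]%classic = (x2 - x1)%:E.
Proof.
rewrite lebesgue_measure_itv/= lte_fin.
by move: x12; rewrite le_eqVlt => /predU1P[->|->]; rewrite ?ltxx ?subrr// -EFinB.
Qed.

Let mu12y : (mu `[x1, x2]%classic < +oo)%E.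
Proof. by rewrite mu12 ltry. Qed.

Let m12 : measurable (`[x1, x2]%classic : set TR). Proof. exact: measurable_itv. Qed.

(** The derivative of [clamped_linear], which has slope [lambda] on [[x1, x2]], slope 0 elsewhere
    and no jumps. *)
Definition clamped_charge : {charge set TR -> \bar R} :=
  cscale lambda (charge_of_finite_measure (mfrestr m12 mu12y)).

Lemma clamped_chargeE A :
  clamped_charge A = (lambda%:E * mu (A `&` `[x1, x2]%classic))%E.
Proof. by []. Qed.

(** The function is the cumulative function of [clamped_charge] shifted by its value [lambda * x1]
    near [l]. *)
Lemma clamped_linear_distributional_derivative :
  distributional_derivative `]l, r[ clamped_linear clamped_charge.
Proof.
have lr : l < r by exact: (lt_trans lx1 (le_lt_trans x12 x2r)).
apply: (@cumulative_distributional_derivative R l r clamped_linear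
  clamped_charge lr (lambda * x1)) => x /=.
rewrite in_itv/= => /andP[lx xr].
rewrite clamped_chargeE /clamped_linear.
have fineM_itv a b : a <= b ->
    fine (lambda%:E * mu `[a, b]%classic)%E = lambda * (b - a).
  move=> ab; rewrite lebesgue_measure_itv/= lte_fin.
  move: ab; rewrite le_eqVlt => /predU1P[->|->]; last by rewrite -EFinB.
  by rewrite ltxx subrr mule0 mulr0.
case: ifPn => [xx1|].
  rewrite (_ : _ `&` _ = set0) ?measure0 ?mule0/= ?add0r//.
  apply/seteqP; split => // y /=; rewrite !in_itv/= => -[/andP[_ yx] /andP[x1y _]].
  by move: (le_lt_trans (le_trans x1y yx) xx1); rewrite ltxx.
rewrite -leNgt => x1x; case: ifPn => [xx2|].
  rewrite (_ : _ `&` _ = `[x1, x]%classic); first by rewrite fineM_itv//; lra.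
  apply/seteqP; split => y /=; rewrite !in_itv/=.
    by move=> [/andP[_ ->] /andP[-> _]].
  by move=> /andP[x1y yx]; rewrite (lt_le_trans lx1)// yx x1y (le_trans yx).
rewrite -ltNge => x2x.
rewrite (_ : _ `&` _ = `[x1, x2]%classic); first by rewrite fineM_itv//; lra.
apply/seteqP; split => y /=; rewrite !in_itv/=; first by move=> [].
by move=> /andP[x1y yx]; rewrite (lt_le_trans lx1)// (le_trans yx (ltW x2x)) x1y yx.
Qed.

Lemma clamped_charge_variation :
  (cvariation clamped_charge `]l, r[ <= (lambda * (x2 - x1))%:E)%E.
Proof.
apply: le_trans (cvariation_nonneg _ (measurable_itv _)) _.
  by move=> A mA; rewrite clamped_chargeE mule_ge0.
rewrite clamped_chargeE EFinM lee_wpmul2l// -mu12 le_measure ?inE//.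
exact: measurableI.
Qed.

Lemma clamped_linear_nondecreasing : {homo clamped_linear : x y / x <= y}.
Proof.
have x1l : lambda * x1 <= lambda * x2 by rewrite ler_wpM2l.
move=> x y xy; rewrite /clamped_linear.
have [xx1|x1x] := ltP x x1; have [yx1|x1y] := ltP y x1 => //.
- by case: ifPn => _ //; rewrite ler_wpM2l.
- by move: (le_lt_trans (le_trans x1x xy) yx1); rewrite ltxx.
have [xx2|x2x] := leP x x2; have [yx2|x2y] := leP y x2 => //.
- by rewrite ler_wpM2l.
- by rewrite ler_wpM2l.
- by move: (lt_le_trans x2x (le_trans xy yx2)); rewrite ltxx.
Qed.

Lemma clamped_linear_measurable (D : set TR) : measurable D ->
  measurable_fun D clamped_linear.
Proof.
move=> mD; apply: nondecreasing_measurable => //.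
exact: clamped_linear_nondecreasing.
Qed.

Lemma clamped_linear_norm x : `|clamped_linear x| <= lambda * `|x1| + lambda * `|x2|.
Proof.
have e1 : 0 <= lambda * `|x1| by rewrite mulr_ge0.
have e2 : 0 <= lambda * `|x2| by rewrite mulr_ge0.
rewrite /clamped_linear; case: ifPn => [_|].
  by rewrite normrM (ger0_norm lambda0) lerDl.
rewrite -leNgt => x1x; case: ifPn => [xx2|_]; last first.
  by rewrite normrM (ger0_norm lambda0) lerDr.
rewrite normrM (ger0_norm lambda0) -mulrDr ler_wpM2l//.
have [x0|x0] := leP 0 x.
  rewrite ger0_norm// (le_trans xx2)// (le_trans (ler_norm x2))//.
  by rewrite lerDr.
rewrite ltr0_norm// (@le_trans _ _ (- x1)) ?lerN2//.
by rewrite (le_trans (ler_norm _))// normrN lerDl.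
Qed.

Lemma clamped_linear_integrable :
  mu.-integrable `]l, r[ (EFin \o clamped_linear).
Proof.
have := integrable_boundedM mu _ (measurable_itv `]l, r[)
  (itv_integrable_cst 1 l r)
  (clamped_linear_measurable (measurable_itv _)) (fun x _ => clamped_linear_norm x).
by apply: eq_integrable => // x _ /=; rewrite mul1r.
Qed.

Lemma clamped_linear_BV : BV `]l, r[ clamped_linear.
Proof.
split; first exact: clamped_linear_integrable.
by exists clamped_charge; exact: clamped_linear_distributional_derivative.
Qed.

Lemma clamped_linear_variation :
  (variation_of_derivative `]l, r[ clamped_linear <= (lambda * (x2 - x1))%:E)%E.
Proof.
apply: le_trans clamped_charge_variation; apply: ereal_inf_lbound.
by exists clamped_charge => //; exact: clamped_linear_distributional_derivative.
Qed.

End clamped_linear.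

(** * Moments of the weight and the choice of the thresholds *)

Section balance.
Variable R : realType.
Local Notation mu := (@lebesgue_measure R).
Local Notation TR := (measurableTypeR R).
Implicit Types (a b c s t x y : R) (p W : R -> R).

Lemma maxr0_norm a : `|Num.max a 0| <= `|a|.
Proof. by case: (leP a 0) => // _; rewrite normr0. Qed.

Lemma maxr0_lipschitz a b : `|Num.max a 0 - Num.max b 0| <= `|a - b|.
Proof.
rewrite ler_norml; have := ler_norm (a - b); have := ler_norm (b - a).
rewrite (distrC b a); set e := `|a - b|.
by case: (leP a 0); case: (leP b 0) => *; apply/andP; split; lra.
Qed.

Definition excess x t := Num.max (t - x) 0.
Definition deficit x t := Num.max (x - t) 0.

Lemma excess_ge0 x t : 0 <= excess x t.
Proof. by rewrite le_max lexx orbT. Qed.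

Lemma deficit_ge0 x t : 0 <= deficit x t.
Proof. by rewrite le_max lexx orbT. Qed.

Lemma excess_measurable x (D : set TR) : measurable_fun D (excess x).
Proof. by apply: measurable_maxr => //; exact: measurable_funB. Qed.

Lemma deficit_measurable x (D : set TR) : measurable_fun D (deficit x).
Proof. by apply: measurable_maxr => //; exact: measurable_funB. Qed.

Variables (l r : R) (W : R -> R) (C : R).
Hypothesis lr : l < r.
Let D : set TR := `]l, r[.
Let mD : measurable D. Proof. exact: measurable_itv. Qed.
Hypothesis mW : measurable_fun D W.
Hypothesis W0 : forall t, 0 <= W t.
Hypothesis WC : forall t, W t <= C.

Lemma weight_integrableM p : measurable_fun D p ->
  (exists M, forall t, D t -> `|p t| <= M) ->
  mu.-integrable D (EFin \o (fun t => W t * p t)).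
Proof.
move=> mp [M pM]; have iW : mu.-integrable D (EFin \o W).
  have WC' t : D t -> `|W t| <= C by rewrite ger0_norm// WC.
  have := integrable_boundedM mu C mD (itv_integrable_cst 1 l r) mW WC'.
  by apply: eq_integrable => // x _ /=; rewrite mul1r.
exact: (integrable_boundedM mu M mD iW mp pM).
Qed.

Lemma weight_integrable : mu.-integrable D (EFin \o W).
Proof.
have : mu.-integrable D (EFin \o (fun t => W t * cst 1 t)).
  by apply: weight_integrableM => //; exists 1 => t _; rewrite normr1.
by apply: eq_integrable => // x _ /=; rewrite mulr1.
Qed.

Let itv_norm t : D t -> `|t| <= `|l| + `|r|.
Proof.
rewrite /D/= in_itv/= => /andP[lt tr]; rewrite ler_norml.
have := ler_norm r; have := ler_norm (- l); rewrite normrN.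
have := normr_ge0 l; have := normr_ge0 r => *; apply/andP; split; lra.
Qed.

Lemma excess_integrable x : mu.-integrable D (EFin \o (fun t => W t * excess x t)).
Proof.
apply: weight_integrableM; first exact: excess_measurable.
exists (`|l| + `|r| + `|x|) => t /itv_norm tlr.
by rewrite (le_trans (maxr0_norm _))// (le_trans (ler_normB _ _))// lerD2r.
Qed.

Lemma deficit_integrable x : mu.-integrable D (EFin \o (fun t => W t * deficit x t)).
Proof.
apply: weight_integrableM; first exact: deficit_measurable.
exists (`|x| + (`|l| + `|r|)) => t /itv_norm tlr.
by rewrite (le_trans (maxr0_norm _))// (le_trans (ler_normB _ _))// lerD2l.
Qed.

Definition mass := \int[mu]_(t in D) W t.
Definition upper_moment x := \int[mu]_(t in D) (W t * excess x t).
Definition lower_moment x := \int[mu]_(t in D) (W t * deficit x t).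

Lemma upper_moment_ge0 x : 0 <= upper_moment x.
Proof. by apply: Rintegral_ge0 => t _; rewrite mulr_ge0// excess_ge0. Qed.

Lemma lower_moment_ge0 x : 0 <= lower_moment x.
Proof. by apply: Rintegral_ge0 => t _; rewrite mulr_ge0// deficit_ge0. Qed.

Lemma upper_moment_r : upper_moment r = 0.
Proof.
apply: eq0_Rintegral => t; rewrite /D/= in_itv/= => /andP[_ tr].
by rewrite /excess max_r ?mulr0// subr_le0 ltW.
Qed.

Lemma lower_moment_l : lower_moment l = 0.
Proof.
apply: eq0_Rintegral => t; rewrite /D/= in_itv/= => /andP[lt _].
by rewrite /deficit max_r ?mulr0// subr_le0 ltW.
Qed.

(** The pointwise Lipschitz bound is integrated against the weight; both moments are instances. *)
Lemma Rintegral_weight_lipschitz (k : R -> R -> R) x y :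
  (forall z, mu.-integrable D (EFin \o (fun t => W t * k z t))) ->
  (forall t, `|k x t - k y t| <= `|x - y|) ->
  `|\int[mu]_(t in D) (W t * k x t) - \int[mu]_(t in D) (W t * k y t)| <=
  mass * `|x - y|.
Proof.
move=> ik kl; rewrite -RintegralB//.
have ikk : mu.-integrable D (EFin \o (fun t => W t * k x t - W t * k y t)).
  exact: (integrableB mD (ik x) (ik y)).
rewrite (le_trans (le_normr_Rintegral mD ikk))//.
rewrite /mass -RintegralZr//; last exact: weight_integrable.
apply: le_Rintegral => //.
- exact: (integrable_norm ikk).
- exact: (integrableZr mD _ weight_integrable).
- by move=> t _; rewrite -mulrBr normrM (ger0_norm (W0 t)) ler_wpM2l.
Qed.

Lemma upper_moment_lipschitz x y :
  `|upper_moment x - upper_moment y| <= mass * `|x - y|.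
Proof.
apply: Rintegral_weight_lipschitz; first exact: excess_integrable.
move=> t; rewrite (le_trans (maxr0_lipschitz _ _))//.
by rewrite opprB addrC addrA subrK -normrN opprB.
Qed.

Lemma lower_moment_lipschitz x y :
  `|lower_moment x - lower_moment y| <= mass * `|x - y|.
Proof.
apply: Rintegral_weight_lipschitz; first exact: deficit_integrable.
move=> t; rewrite (le_trans (maxr0_lipschitz _ _))//.
by rewrite opprB addrA subrK.
Qed.

Lemma mass_ge0 : 0 <= mass.
Proof. exact: Rintegral_ge0. Qed.

Lemma lipschitz_mass_continuous (F : R -> R) :
  (forall x y, `|F x - F y| <= mass * `|x - y|) -> continuous F.
Proof.
move=> lF x; apply/cvgrPdist_le => /= e e0.
(* The constant [mass] may vanish, and a positive one is needed for the division. *)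
have m0 : 0 < mass + 1 by rewrite ltr_wpDl// mass_ge0.
near=> y.
rewrite (le_trans (lF _ _))// (@le_trans _ _ ((mass + 1) * `|x - y|))//.
  by rewrite ler_wpM2r// lerDl.
rewrite mulrC -ler_pdivlMr//; near: y.
by apply: cvgr_dist_le; [exact: cvg_id|exact: divr_gt0].
Unshelve. all: by end_near. Qed.

(** A nonnegative function with zero integral vanishes a.e., and the factor [p] is positive, so [W]
    vanishes a.e. Used to see that the moments at the far end points are nonzero for a nonzero
    weight. *)
Lemma weight_mass_eq0 p : measurable_fun D p ->
  (forall t, D t -> 0 < p t) ->
  mu.-integrable D (EFin \o (fun t => W t * p t)) ->
  \int[mu]_(t in D) (W t * p t) = 0 -> mass = 0.
Proof.
move=> mp p0 iWp Wp0.
have mWp : measurable_fun D (EFin \o (fun t => W t * p t)).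
  exact: (measurable_int mu iWp).
have /(ae_eq_integral_abs mu mD mWp) Wp_ae :
    (\int[mu]_(t in D) `|(EFin \o (fun t => W t * p t)%R) t| = 0)%E.
  transitivity (\int[mu]_(t in D) (W t * p t)%R%:E)%E.
    apply: eq_integral => t /set_mem Dt.
    by rewrite /= ger0_norm// mulr_ge0// ltW// p0.
  by rewrite -[LHS]fineK ?integrable_fin_num//; congr EFin.
transitivity (\int[mu]_(t in D) (cst 0 t : R)); last exact: eq0_Rintegral.
apply: (@ae_eq_Rintegral _ TR R mu) => //.
move: Wp_ae; apply: filterS => t Wpt Dt.
have /eqP := Wpt Dt; rewrite /= eqe mulf_eq0 => /orP[/eqP//|/eqP pt0].
by have := p0 t Dt; rewrite pt0 ltxx.
Qed.

(** The intermediate value theorem for the difference of the moments, which is negative at [l] and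
    positive at [r] when the weight has mass. *)
Lemma balanced_point : exists c, [/\ l < c, c < r & lower_moment c = upper_moment c].
Proof.
(* Without mass both moments vanish identically and the midpoint serves. *)
have [m0|m0] := eqVneq mass 0.
  have lcst x : lower_moment x = 0.
    have := lower_moment_lipschitz x l.
    by rewrite m0 mul0r lower_moment_l subr0 normr_le0 => /eqP.
  have ucst x : upper_moment x = 0.
    have := upper_moment_lipschitz x r.
    by rewrite m0 mul0r upper_moment_r subr0 normr_le0 => /eqP.
  by exists ((l + r) / 2); rewrite lcst ucst; move: lr => lr'; split => //; lra.
have u_neq0 : upper_moment l != 0.
  apply: contraNneq m0 => ul0; apply/eqP.
  apply: (@weight_mass_eq0 (excess l)) => //.
  - exact: excess_measurable.
  - move=> t; rewrite /D/= in_itv/= => /andP[lt _].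
    by rewrite lt_max subr_gt0 lt.
  - exact: excess_integrable.
have l_neq0 : lower_moment r != 0.
  apply: contraNneq m0 => lr0; apply/eqP.
  apply: (@weight_mass_eq0 (deficit r)) => //.
  - exact: deficit_measurable.
  - move=> t; rewrite /D/= in_itv/= => /andP[_ tr].
    by rewrite lt_max subr_gt0 tr.
  - exact: deficit_integrable.
pose F x := lower_moment x - upper_moment x.
have cF : {within `[l, r], continuous F}.
  apply: continuous_subspaceT => x; apply: cvgB;
    apply: lipschitz_mass_continuous => y z.
    exact: lower_moment_lipschitz.
  exact: upper_moment_lipschitz.
have Fl : F l < 0.
  by rewrite /F lower_moment_l sub0r oppr_lt0 lt_neqAle eq_sym u_neq0 upper_moment_ge0.
have Fr : 0 < F r.
  by rewrite /F upper_moment_r subr0 lt_neqAle eq_sym l_neq0 lower_moment_ge0.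
have [|c clr Fc] := @IVT _ F l r 0 (ltW lr) cF.
  by rewrite ge_min le_max (ltW Fl) (ltW Fr) orbT.
(* The strict signs of [F] at the end points keep its zero in the open interval. *)
exists c; move: clr; rewrite in_itv/= => /andP[lc cr]; split.
- rewrite lt_neqAle lc andbT; apply: contra_eqN Fc => /eqP <-.
  by rewrite lt_eqF.
- rewrite lt_neqAle cr andbT; apply: contra_eqN Fc => /eqP ->.
  by rewrite gt_eqF.
- by apply/eqP; rewrite -subr_eq0 -/(F c) Fc.
Qed.

(** The last equation encodes the alternative [s = 1] or [x1 = x2]. *)
Lemma balanced_thresholds lambda : 0 < lambda ->
  exists x1 x2 s, [/\ l < x1, x1 <= x2 & x2 < r] /\
    [/\ lambda * lower_moment x1 = s, lambda * upper_moment x2 = s, s <= 1 &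
        s * (x2 - x1) = x2 - x1].
Proof.
move=> lambda0; have [c [lc cr lu]] := balanced_point.
have [s1|s1] := leP (lambda * lower_moment c) 1.
  exists c, c, (lambda * lower_moment c); split; split => //.
    by rewrite lu.
  by rewrite subrr mulr0.
have cL : continuous (fun x => lambda * lower_moment x).
  move=> x; apply: cvgM; first exact: cvg_cst.
  exact: (lipschitz_mass_continuous lower_moment_lipschitz).
have cU : continuous (fun x => lambda * upper_moment x).
  move=> x; apply: cvgM; first exact: cvg_cst.
  exact: (lipschitz_mass_continuous upper_moment_lipschitz).
(* The scaled lower moment is 0 at [l] and exceeds 1 at [c], so it takes the value 1 between them;
   the upper moment does the same between [r] and [c]. *)
have [|x1 + x1E] := @IVT _ (fun x => lambda * lower_moment x) l c 1 (ltW lc)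
    (continuous_subspaceT cL).
  by rewrite lower_moment_l mulr0 ge_min le_max ler01 (ltW s1) orbT.
have [|x2 + x2E] := @IVT _ (fun x => lambda * upper_moment x) c r 1 (ltW cr)
    (continuous_subspaceT cU).
  by rewrite upper_moment_r mulr0 -lu ge_min le_max ler01 (ltW s1) orbT.
rewrite !in_itv/= => /andP[cx2 x2r] /andP[lx1 x1c].
exists x1, x2, 1; split; split => //.
- rewrite lt_neqAle lx1 andbT; apply: contra_eqN x1E => /eqP <-.
  by rewrite lower_moment_l mulr0 eq_sym oner_eq0.
- exact: le_trans cx2.
- rewrite lt_neqAle x2r andbT; apply: contra_eqN x2E => /eqP ->.
  by rewrite upper_moment_r mulr0 eq_sym oner_eq0.
- by rewrite mul1r.
Qed.

End balance.

(** * Optimality of the candidate for a bounded nonnegative weight *)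

Section optimality.
Variable R : realType.
Local Notation mu := (@lebesgue_measure R).
Local Notation TR := (measurableTypeR R).

Lemma ge0_subset_Rintegral (A B : set TR) (f : R -> R) : measurable A -> measurable B ->
  A `<=` B -> mu.-integrable B (EFin \o f) -> (forall x, 0 <= f x) ->
  \int[mu]_(x in A) f x <= \int[mu]_(x in B) f x.
Proof.
move=> mA mB AB intf f0; rewrite fine_le//.
- by apply: integrable_fin_num => //; exact: integrableS intf.
- exact: integrable_fin_num intf.
- apply: ge0_subset_integral => //; first exact: (measurable_int mu intf).
  by move=> x _; rewrite lee_fin.
Qed.

(** The right-hand side may be infinite, so the fidelity of a competitor can be bounded below
    without first showing that it is finite. *)
Lemma Rintegral_le_ge0_integral (A : set TR) (f k : R -> R) : measurable A ->
  mu.-integrable A (EFin \o f) -> measurable_fun A k ->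
  (forall x, 0 <= k x) -> (forall x, f x <= k x) ->
  ((\int[mu]_(x in A) f x)%:E <= \int[mu]_(x in A) (k x)%:E)%E.
Proof.
move=> mA intf mk k0 fk; rewrite /Rintegral fineK; last exact: integrable_fin_num intf.
have [->|kfin] := eqVneq (\int[mu]_(x in A) (k x)%:E)%E +oo%E; first by rewrite leey.
apply: le_integral => //.
  apply/integrableP; split; first exact/measurable_EFinP.
  under eq_integral do rewrite gee0_abs ?lee_fin//.
  by rewrite ltey.
by move=> x _; rewrite lee_fin.
Qed.

Variables (l r lambda x1 x2 s C : R) (W : R -> R).
Hypotheses (lr : l < r) (lambda0 : 0 < lambda).
Let D : set TR := `]l, r[.
Let mD : measurable D. Proof. exact: measurable_itv. Qed.
Hypothesis mW : measurable_fun D W.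
Hypothesis W0 : forall t, 0 <= W t.
Hypothesis WC : forall t, W t <= C.
Hypotheses (lx1 : l < x1) (x12 : x1 <= x2) (x2r : x2 < r).
Hypothesis lower_s : lambda * lower_moment l r W x1 = s.
Hypothesis upper_s : lambda * upper_moment l r W x2 = s.
Hypothesis s_le1 : s <= 1.
Hypothesis sx12 : s * (x2 - x1) = x2 - x1.

Local Notation u := (clamped_linear x1 x2 lambda).

Let P t := W t * deficit x1 t.
Let Q t := W t * excess x2 t.
Let iP : mu.-integrable D (EFin \o P).
Proof. exact: (deficit_integrable mW W0 WC). Qed.
Let iQ : mu.-integrable D (EFin \o Q).
Proof. exact: (excess_integrable mW W0 WC). Qed.

(* The derivative of the fidelity term at the candidate [u]. *)
Let g t := lambda * P t - lambda * Q t.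

Lemma clamped_linear_sub t : u t - lambda * t = lambda * (deficit x1 t - excess x2 t).
Proof.
rewrite /clamped_linear /deficit /excess.
have [tx1|x1t] := ltP t x1.
  rewrite max_l ?subr_ge0 ?ltW// max_r ?subr_le0 ?(le_trans (ltW tx1))//; lra.
rewrite max_r ?subr_le0//.
have [tx2|x2t] := leP t x2; first by rewrite max_r ?subr_le0//; lra.
by rewrite max_l ?subr_ge0 ?ltW//; lra.
Qed.

Let gE t : g t = W t * (u t - lambda * t).
Proof. by rewrite clamped_linear_sub /g /P /Q; lra. Qed.

(** Where [P] is nonzero [u] equals [lambda * x1], and where [Q] is nonzero it equals
    [lambda * x2]. *)
Let guE t : g t * u t = (lambda * x1 * lambda) * P t - (lambda * x2 * lambda) * Q t.
Proof.
have Pu : P t * u t = P t * (lambda * x1).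
  rewrite /P /clamped_linear /deficit; have [tx1//|x1t] := ltP t x1.
  by rewrite max_r ?subr_le0// mulr0 !mul0r.
have Qu : Q t * u t = Q t * (lambda * x2).
  rewrite /Q /clamped_linear /excess; have [tx2|x2t] := leP t x2.
    by rewrite max_r ?subr_le0// mulr0 !mul0r.
  by rewrite ltNge (le_trans x12 (ltW x2t)).
by rewrite /g mulrBl -(mulrA _ (P t)) -(mulrA _ (Q t)) Pu Qu; lra.
Qed.

Let u_norm t : `|u t| <= lambda * `|x1| + lambda * `|x2|.
Proof. exact/clamped_linear_norm/ltW. Qed.

Let measurable_u : measurable_fun D u.
Proof. exact: (clamped_linear_measurable x12 (ltW lambda0) mD). Qed.

Let mg : measurable_fun D g.
Proof.
rewrite (funext gE); apply: measurable_funM => //.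
by apply: measurable_funB => //; exact: measurable_funM.
Qed.

(** A bound for [|u t - lambda * t|] on the interval, where [|t|] is at most [|l| + |r|]. *)
Let N := lambda * `|x1| + lambda * `|x2| + lambda * (`|l| + `|r|).

Let sub_norm t : D t -> `|u t - lambda * t| <= N.
Proof.
rewrite /D/= in_itv/= => /andP[lt tr].
rewrite (le_trans (ler_normB _ _))// lerD ?u_norm// normrM (gtr0_norm lambda0).
rewrite ler_wpM2l ?(ltW lambda0)// ler_norml.
have := ler_norm r; have := ler_norm (- l); rewrite normrN.
have := normr_ge0 l; have := normr_ge0 r => *; apply/andP; split; lra.
Qed.

Let g_norm t : D t -> `|g t| <= C * N.
Proof.
move=> Dt; rewrite gE normrM (ger0_norm (W0 t)) ler_pM//.
exact: sub_norm.
Qed.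

Let ig : mu.-integrable D (EFin \o g).
Proof.
exact: (integrableB mD (integrableZl mD lambda iP) (integrableZl mD lambda iQ)).
Qed.

Let int_g : \int[mu]_(t in D) g t = 0.
Proof.
rewrite RintegralB//; last 2 first.
- exact: (integrableZl mD lambda iP).
- exact: (integrableZl mD lambda iQ).
by rewrite !RintegralZl// [X in X - _]lower_s [X in _ - X]upper_s subrr.
Qed.

(** The tails of [lambda * P] and [lambda * Q] both lie between 0 and [s], so their difference is at
    most [s <= 1] in absolute value. *)
Let tail_g y : D y -> `|\int[mu]_(t in `[y, r[) g t| <= 1.
Proof.
rewrite /D/= in_itv/= => /andP[ly yr].
have sub : `[y, r[ `<=` D by apply: subset_itv => //; rewrite bnd_simp.
have iPy : mu.-integrable `[y, r[ (EFin \o P) by exact: integrableS iP.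
have iQy : mu.-integrable `[y, r[ (EFin \o Q) by exact: integrableS iQ.
have myr : measurable (`[y, r[%classic : set TR) by exact: measurable_itv.
rewrite RintegralB//; last 2 first.
- exact: (integrableZl myr lambda iPy).
- exact: (integrableZl myr lambda iQy).
rewrite !RintegralZl//.
have P0 t : 0 <= P t by rewrite mulr_ge0// deficit_ge0.
have Q0 t : 0 <= Q t by rewrite mulr_ge0// excess_ge0.
have Ps : lambda * \int[mu]_(t in `[y, r[) P t <= s.
  by rewrite -lower_s ler_wpM2l ?(ltW lambda0)//; exact: ge0_subset_Rintegral.
have Qs : lambda * \int[mu]_(t in `[y, r[) Q t <= s.
  by rewrite -upper_s ler_wpM2l ?(ltW lambda0)//; exact: ge0_subset_Rintegral.
have Py : 0 <= lambda * \int[mu]_(t in `[y, r[) P t.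
  by rewrite mulr_ge0 ?(ltW lambda0)//; exact: Rintegral_ge0.
have Qy : 0 <= lambda * \int[mu]_(t in `[y, r[) Q t.
  by rewrite mulr_ge0 ?(ltW lambda0)//; exact: Rintegral_ge0.
rewrite ler_norml; move: s_le1 Ps Qs Py Qy.
set p := lambda * _; set q := lambda * _ => s1 ps qs p0 q0.
by apply/andP; split; lra.
Qed.

Let int_gu : \int[mu]_(t in D) (g t * u t) = - (lambda * (x2 - x1)).
Proof.
under eq_Rintegral do rewrite guE.
rewrite RintegralB//; last 2 first.
- exact: (integrableZl mD _ iP).
- exact: (integrableZl mD _ iQ).
rewrite !RintegralZl// -[in X in X - _]mulrA -[in X in _ - X]mulrA.
(* Both moments equal [s], which leaves [- lambda * s * (x2 - x1)]; [sx12] absorbs the factor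
   [s]. *)
rewrite [X in _ * X - _]lower_s [X in _ - _ * X]upper_s -sx12; lra.
Qed.

Let variation_ge v : BV `]l, r[ v ->
  ((- \int[mu]_(t in D) (g t * v t))%:E <= variation_of_derivative `]l, r[ v)%E.
Proof.
move=> [iv _]; apply/ereal_infP => _ [nu dv <-].
apply: (le_trans _ (pairing_le_variation lr iv dv mg g_norm int_g tail_g)).
by rewrite lee_fin -normrN ler_norm.
Qed.

Let igM p : mu.-integrable D (EFin \o p) ->
  mu.-integrable D (EFin \o (fun t => g t * p t)).
Proof.
move=> ip; have := integrable_boundedM mu (C * N) mD ip mg g_norm.
by apply: eq_integrable => // t _ /=; rewrite mulrC.
Qed.

Let iu : mu.-integrable D (EFin \o u).
Proof. exact: (clamped_linear_integrable l r x12 (ltW lambda0)). Qed.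

(** The integrand is [g t * (u t - lambda * t)], an integrable function times a bounded one. *)
Let isqr : mu.-integrable D (EFin \o (fun t => W t * (lambda * t - u t) ^+ 2)).
Proof.
have msub : measurable_fun D (fun t => u t - lambda * t).
  by apply: measurable_funB => //; exact: measurable_funM.
have := integrable_boundedM mu N mD ig msub sub_norm.
by apply: eq_integrable => // t _ /=; congr EFin; rewrite gE; lra.
Qed.

(** The convex fidelity lies above its tangent at [u], whose slope is [2 * g]; the term
    [lambda * (x2 - x1)] is minus the integral of [g * u]. *)
Let fidelity_ge v : mu.-integrable D (EFin \o v) ->
  ((\int[mu]_(t in D) (W t * (lambda * t - u t) ^+ 2) +
    2 * (\int[mu]_(t in D) (g t * v t) + lambda * (x2 - x1)))%:E <=
   \int[mu]_(t in D) (W t * (lambda * t - v t) ^+ 2)%:E)%E.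
Proof.
move=> iv; have igv := igM iv; have igu := igM iu.
have igvu : mu.-integrable D (EFin \o (fun t => g t * v t - g t * u t)).
  exact: (integrableB mD igv igu).
have i2 : mu.-integrable D (EFin \o (fun t => 2 * (g t * v t - g t * u t))).
  exact: (integrableZl mD 2 igvu).
have -> : \int[mu]_(t in D) (g t * v t) + lambda * (x2 - x1) =
    \int[mu]_(t in D) (g t * v t - g t * u t).
  by rewrite RintegralB// int_gu opprK.
rewrite -RintegralZl// -RintegralD//; apply: Rintegral_le_ge0_integral => //.
- exact: (integrableD mD isqr i2).
- apply: measurable_funM => //; apply: measurable_funX.
  apply: measurable_funB; first exact: measurable_funM.
  by apply/measurable_EFinP; exact: (measurable_int mu iv).
- by move=> t; rewrite mulr_ge0// sqr_ge0.
(* The two sides differ by [W t * (v t - u t) ^+ 2]. *)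
- move=> t; rewrite -subr_ge0 gE.
  have := mulr_ge0 (W0 t) (sqr_ge0 (v t - u t)).
  by congr (0 <= _); lra.
Qed.

(** With [G] the integral of [g * v], half the fidelity grows by at least [G + lambda * (x2 - x1)]
    from [u] to [v], while the variation of [v] is at least [- G]. In the sum [G] cancels and the
    bound on the variation of [u] remains. *)
Lemma clamped_linear_optimal v : BV `]l, r[ v ->
  (energy `]l, r[ W (fun x => lambda * x)%R u <=
   energy `]l, r[ W (fun x => lambda * x)%R v)%E.
Proof.
move=> bv; have [iv _] := bv; rewrite /energy.
set S := (\int[mu]_(t in D) (W t * (lambda * t - u t) ^+ 2)).
have SE : (\int[mu]_(t in D) (W t * (lambda * t - u t) ^+ 2)%:E)%E = S%:E.
  by rewrite /S /Rintegral fineK//; exact: integrable_fin_num.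
rewrite SE; set G := \int[mu]_(t in D) (g t * v t).
apply: (@le_trans _ _ ((2^-1)%:E * S%:E + (lambda * (x2 - x1))%:E)%E).
  by rewrite leeD2l//; exact: clamped_linear_variation (ltW lambda0).
apply: (@le_trans _ _ ((2^-1)%:E * (S + 2 * (G + lambda * (x2 - x1)))%:E + (- G)%:E)%E).
  by rewrite -!EFinM -!EFinD lee_fin; lra.
rewrite leeD//; last exact: variation_ge.
by rewrite lee_wpmul2l ?lee_fin ?invr_ge0//; exact: fidelity_ge.
Qed.

End optimality.

(** * Passage from an essentially bounded weight to a bounded one, and the conclusion *)

Lemma energy_ae_eq (R : realType) (D : set (measurableTypeR R)) (w W f v : R -> R) :
  measurable D -> measurable_fun D w -> measurable_fun D W ->
  measurable_fun D f -> measurable_fun D v ->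
  {ae @lebesgue_measure R, forall x, D x -> w x = W x} ->
  energy D w f v = energy D W f v.
Proof.
move=> mD mw mW mf mv wW; rewrite /energy; congr (_ * _ + _)%E.
apply: ae_eq_integral => //.
- apply/measurable_EFinP/measurable_funM => //.
  by apply/measurable_funX/measurable_funB.
- apply/measurable_EFinP/measurable_funM => //.
  by apply/measurable_funX/measurable_funB.
- by move: wW; apply: filterS => x wWx Dx; rewrite wWx.
Qed.

Lemma Lfun_infty_bounded (R : realType) (f : R -> R) :
  f \in Lfun (@lebesgue_measure R) +oo%E ->
  exists2 C, 0 <= C & {ae @lebesgue_measure R, forall x, `|f x| <= C}.
Proof.
move=> /andP[_]; rewrite inE/= /finite_norm unlock /Lnorm.
(* The norm of exponent [+oo] is the essential supremum only if the whole space has positive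
   measure; the interval []0, 1[] shows that it has. *)
rewrite ifT; last first.
  apply: (@lt_le_trans _ _ (@lebesgue_measure R `]0, 1[%classic)).
    by rewrite lebesgue_measure_itv/= lte_fin ltr01 -EFinB lte_fin subr0 ltr01.
  by apply: le_measure; rewrite ?inE.
move=> /ess_supr_bounded[M fM]; exists `|M| => //.
move: fM; apply: filterS => x /le_trans; apply; exact: ler_norm.
Qed.

Theorem proposition6p3 (R : realType) (L lambda : R) (w : R -> R)
    (L_gt0 : 0 < L) (lambda_gt0 : 0 < lambda)
    (w_Linfty : w \_ `]-L, L[ \in Lfun (@lebesgue_measure R) +oo%E)
    (w_ge0 : {ae @lebesgue_measure R, forall x, x \in `]-L, L[ -> 0 <= w x}) :
  exists x1 x2 : R, [/\ - L < x1, x1 <= x2, x2 < L &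
    is_solution `]-L, L[ w (fun x => lambda * x)
      (fun x => if x < x1 then lambda * x1
                else if x <= x2 then lambda * x
                else lambda * x2)].
Proof.
set D := `]- L, L[%classic; pose mu := @lebesgue_measure R.
have lr : - L < L by move: L_gt0; lra.
have mD : measurable (D : set (measurableTypeR R)) by exact: measurable_itv.
have mwD : measurable_fun setT (w \_ D : measurableTypeR R -> R).
  by have := sub_Lfun_mfun w_Linfty; rewrite inE.
have mw : measurable_fun D (w : measurableTypeR R -> R).
  exact: ((measurable_restrictT w mD).2 mwD).
have [C C0 wC] := Lfun_infty_bounded w_Linfty.
(* A truncation of [|w|], bounded everywhere and equal to [w] a.e. on [D]. *)
pose W := (fun x => `|(w \_ D) x|) \min cst C.
have mW : measurable_fun D (W : measurableTypeR R -> R).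
  apply: measurable_funTS; apply: measurable_minr => //.
  exact: measurableT_comp.
have W0 x : 0 <= W x by rewrite /W/= le_min normr_ge0.
have WC x : W x <= C by rewrite /W/= ge_min lexx orbT.
have wW : {ae mu, forall x, D x -> w x = W x}.
  move: wC w_ge0; apply: filterS2; first exact: (ae_filter_ringOfSetsType mu).
  move=> x wxC wx0 Dx.
  have wx : 0 <= w x by apply: wx0; rewrite inE in Dx *.
  by rewrite /W/= min_l// patchE mem_set// ger0_norm.
have [x1 [x2 [s [[lx1 x12 x2r] [ls us s1 sx]]]]] :=
  balanced_thresholds lr mW W0 WC lambda_gt0.
exists x1, x2; split => //; split.
  exact: clamped_linear_BV (ltW lambda_gt0).
move=> v bv; have [iv _] := bv.
have mf : measurable_fun D ((fun x => lambda * x) : measurableTypeR R -> R).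
  exact: measurable_funM.
have mv : measurable_fun D (v : measurableTypeR R -> R).
  by apply/measurable_EFinP; exact: (measurable_int mu iv).
have measurable_u := clamped_linear_measurable x12 (ltW lambda_gt0) mD.
rewrite (energy_ae_eq mD mw mW mf mv wW) (energy_ae_eq mD mw mW mf measurable_u wW).
exact: (clamped_linear_optimal lr lambda_gt0 mW W0 WC lx1 x12 x2r ls us s1 sx bv).
Qed.
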